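(* Let $\mathcal{A}$ be a non-unital associative complex algebra and let $\mathfrak{A} = \mathcal{A} \oplus \mathbb{C}$ be its unitization, with identity $(0,1)$. Then for every non-negative integer $n$, all $a, b, c \in \mathcal{A}$ and all $\alpha, \beta, \gamma \in \mathbb{C}$, the following identities hold in $\mathfrak{A}$: $$(a,\alpha)^{n} = \sum_{k=0}^{n} \binom{n}{k}\, \Delta_{(a,\alpha),(b,\beta)}^{\,n-k}(0,1)\,(b,\beta)^{k},$$ and consequently, identifying each $x \in \mathcal{A}$ with $(x,0) \in \mathfrak{A}$, $$a^{n} = \sum_{k=0}^{n} \binom{n}{k}\, \Delta_{(a,0),(b,\beta)}^{\,n-k}(0,1)\,(b,\beta)^{k},$$ $$(a+b)^{n} = \sum_{k=0}^{n} \binom{n}{k}\, \Delta_{(a+b,0),(c,\gamma)}^{\,n-k}(0,1)\,(c,\gamma)^{k}.$$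
   Context: The unitization $\mathfrak{A} = \mathcal{A}\oplus\mathbb{C}$ is the set of pairs $(a,\lambda)$ with $a\in\mathcal{A}$, $\lambda\in\mathbb{C}$, with operations $(a,\lambda)+(b,\mu) = (a+b,\lambda+\mu)$, $\mu(a,\lambda) = (\mu a, \mu\lambda)$ and $(a,\lambda)(b,\mu) = (ab+\lambda b+\mu a, \lambda\mu)$. It is a unital algebra with identity $(0,1)$, and $a \mapsto (a,0)$ embeds $\mathcal{A}$ as an ideal of codimension one; under the identification of $x$ with $(x,0)$, $x^n$ means $(x,0)^n$ (for $n=0$ this is $(0,1)$). For $(a,\alpha),(b,\beta)\in\mathfrak{A}$ the linear map $\Delta_{(a,\alpha),(b,\beta)}:\mathfrak{A}\to\mathfrak{A}$ is defined by $\Delta_{(a,\alpha),(b,\beta)}(c,\gamma) = (a,\alpha)(c,\gamma) - (c,\gamma)(b,\beta)$. $\Delta^{m}$ denotes $m$-fold composition, with $\Delta^0$ the identity map, and zeroth powers of elements of $\mathfrak{A}$ equal $(0,1)$. *)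

(* Defs.v *)
From HB Require Import structures.
From mathcomp Require Import all_boot all_order all_algebra.
From mathcomp Require Export reals complex.

Set Implicit Arguments.
Unset Strict Implicit.
Unset Printing Implicit Defensive.

Import GRing.Theory.
Local Open Scope ring_scope.

(* Associative algebras not required to have an identity; MathComp's
   algType bundles one. *)
HB.mixin Record Lmodule_isNuAlgebra (K : comNzRingType) A of GRing.Lmodule K A := {
  numul : A -> A -> A;
  numulA : associative numul;
  numulDl : left_distributive numul +%R;
  numulDr : right_distributive numul +%R;
  numulZl : forall (k : K) (a b : A), numul (k *: a) b = k *: numul a b;
  numulZr : forall (k : K) (a b : A), numul a (k *: b) = k *: numul a b
}.

#[short(type="nuAlgType")]
HB.structure Definition NuAlgebra (K : comNzRingType) :=
  {A of GRing.Lmodule K A & Lmodule_isNuAlgebra K A}.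

Definition has_identity (K : comNzRingType) (A : nuAlgType K) : Prop :=
  exists e : A, forall a : A, numul e a = a /\ numul a e = a.

(* K^o makes the componentwise operations of the product those of an
   lmodType K. *)
Definition unitization (K : comNzRingType) (A : nuAlgType K) : Type :=
  (A * K^o)%type.

#[warnings="-redundant-canonical-projection"]
HB.instance Definition _ (K : comNzRingType) (A : nuAlgType K) :=
  GRing.Lmodule.on (unitization A).

Section UnitizationAlgebra.
Variables (K : comNzRingType) (A : nuAlgType K).
Implicit Types x y z : unitization A.

Definition upair (a : A) (k : K) : unitization A := (a, k).

Definition uone : unitization A := upair 0 1.

Definition umul x y : unitization A :=
  upair (numul x.1 y.1 + (x.2 : K) *: y.1 + (y.2 : K) *: x.1) (x.2 * y.2).

Lemma numul0l (a : A) : numul 0 a = 0.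
Proof. by rewrite -(scale0r (0 : A)) numulZl !scale0r. Qed.

Lemma numul0r (a : A) : numul a 0 = 0.
Proof. by rewrite -(scale0r (0 : A)) numulZr !scale0r. Qed.

Lemma umulA : associative umul.
Proof.
move=> [a k] [b l] [c m]; congr pair; rewrite /= ?mulrA //.
rewrite !numulDl !numulDr !numulZl !numulZr numulA !scalerDr !scalerA.
rewrite (mulrC m k) (mulrC m l) -!addrA; congr (_ + _).
rewrite [RHS]addrCA; congr (_ + _).
by rewrite addrCA; congr (_ + _); rewrite addrCA.
Qed.

Lemma umul1l : left_id uone umul.
Proof.
move=> [a k]; congr pair; rewrite /= ?mul1r //.
by rewrite numul0l scale1r scaler0 add0r addr0.
Qed.

Lemma umul1r : right_id uone umul.
Proof.
move=> [a k]; congr pair; rewrite /= ?mulr1 //.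
by rewrite numul0r scale1r scaler0 !add0r.
Qed.

Lemma umulDl : left_distributive umul +%R.
Proof.
move=> [a k] [b l] [c m]; congr pair; rewrite /= ?mulrDl //.
by rewrite numulDl scalerDl scalerDr (addrACA (numul a c)) [LHS]addrACA.
Qed.

Lemma umulDr : right_distributive umul +%R.
Proof.
move=> [a k] [b l] [c m]; congr pair; rewrite /= ?mulrDr //.
by rewrite numulDr scalerDl scalerDr (addrACA (numul a b)) [LHS]addrACA.
Qed.

Lemma uone_neq0 : uone != 0.
Proof. by apply/eqP => -[] /eqP; rewrite oner_eq0. Qed.

HB.instance Definition _ := GRing.Zmodule_isNzRing.Build (unitization A)
  umulA umul1l umul1r umulDl umulDr uone_neq0.

Lemma uscaleAl (k : K) x y : k *: (x * y) = (k *: x) * y.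
Proof.
case: x y => [a l] [b m]; congr pair; rewrite /= -?scalerAl //.
by rewrite numulZl !scalerDr !scalerA (mulrC m).
Qed.

HB.instance Definition _ :=
  GRing.Lmodule_isLalgebra.Build K (unitization A) uscaleAl.

Lemma uscaleAr (k : K) x y : k *: (x * y) = x * (k *: y).
Proof.
case: x y => [a l] [b m]; congr pair; rewrite /= -?scalerAr //.
by rewrite numulZr !scalerDr !scalerA (mulrC l).
Qed.

HB.instance Definition _ :=
  GRing.Lalgebra_isAlgebra.Build K (unitization A) uscaleAr.

Definition uembed (a : A) : unitization A := upair a 0.

Definition Delta x y : unitization A -> unitization A :=
  fun z => x * z - z * y.

Lemma Delta_linear x y : linear (Delta x y).
Proof.
move=> k z w; rewrite /Delta mulrDr mulrDl scalerBr -scalerAr -scalerAl.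
by rewrite opprD addrACA.
Qed.

HB.instance Definition _ x y :=
  GRing.isLinear.Build K (unitization A) (unitization A) *:%R (Delta x y)
    (Delta_linear x y).

End UnitizationAlgebra.

(* Main.v *)
Require Import Defs.
From mathcomp Require Import all_boot all_order all_algebra.
Import GRing.Theory.
Local Open Scope ring_scope.

(** All three identities are the case [z = 1], for suitable [x] and [y]. Keeping [z] general lets
    the induction run: [x * z = Delta x y z + z * y], and the hypothesis is applied at [Delta x y z]
    and at [z], the latter then multiplied by [y] on the right. Pascal's rule recombines the two
    sums. *)

(* Left multiplication by x is the sum of the commuting maps [Delta x y] and
   right multiplication by y, so this is the binomial theorem for that sum. *)
Lemma exprM_Delta (K : comNzRingType) (A : nuAlgType K) (x y z : unitization A)
    (n : nat) :
  x ^+ n * z =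
    \sum_(0 <= k < n.+1) (iter (n - k) (Delta x y) z * y ^+ k) *+ 'C(n, k).
Proof.
elim: n z => [|n IHn] z; first by rewrite big_nat1 expr0 mul1r mulr1.
have xzE : x * z = Delta x y z + z * y by rewrite /Delta subrK.
rewrite exprSr -mulrA xzE mulrDr mulrA !IHn mulr_suml [RHS]big_nat_recl //.
under [X in _ = _ + X]eq_bigr do rewrite binS mulrnDr subSS.
rewrite big_split addrA /=; congr (_ + _); last first.
  by apply: eq_bigr => k _; rewrite mulrnAl -mulrA -exprSr.
(* The [k = 0] term and the ['C(n, k.+1)] half of Pascal's rule form one sum of [G]; its last term,
   at [n.+1], vanishes since ['C(n, n.+1) = 0]. *)
pose G k := (iter (n.+1 - k) (Delta x y) z * y ^+ k) *+ 'C(n, k).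
transitivity (\sum_(0 <= k < n.+2) G k).
  rewrite [RHS]big_nat_recr //= {2}/G bin_small // addr0.
  by apply: eq_big_nat => k /andP[_ lt_kn]; rewrite /G subSn // iterSr.
by rewrite [LHS]big_nat_recl // /G !bin0.
Qed.

Theorem mainTheorem3 (R : realType) (A : nuAlgType R[i])
  (A_nonunital : ~ has_identity A)
  (n : nat) (a b c : A) (alpha beta gamma : R[i]) :
  [/\ upair a alpha ^+ n =
        \sum_(0 <= k < n.+1)
          (iter (n - k) (Delta (upair a alpha) (upair b beta)) (upair 0 1)
             * upair b beta ^+ k) *+ 'C(n, k),
      uembed a ^+ n =
        \sum_(0 <= k < n.+1)
          (iter (n - k) (Delta (uembed a) (upair b beta)) (upair 0 1)
             * upair b beta ^+ k) *+ 'C(n, k)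
    & uembed (a + b) ^+ n =
        \sum_(0 <= k < n.+1)
          (iter (n - k) (Delta (uembed (a + b)) (upair c gamma)) (upair 0 1)
             * upair c gamma ^+ k) *+ 'C(n, k)].
Proof.
(* [upair 0 1] is by definition the ring's [1], so [mulr1] removes it. *)
by split; rewrite -exprM_Delta [RHS]mulr1.
Qed.
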